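(* Let $a>1$ and $d>1$ be positive integers such that $d$ is even and $\gcd(a,d)=1$. Let $\mathcal{P}_{a,d}=\{a+kd : k\in\mathbb{Z}\}$, and let $f:\mathbb{Z}\to\mathbb{C}$ be a multiplicative function such that $f(a)\neq 0$. Then $$f(u+v)=f(u)+f(v)\quad\text{for all } u,v\in\mathcal{P}_{a,d}$$ if and only if one of the following holds: (1) $d\equiv 0 \pmod 4$, $f(2)=2$, and there exists a Dirichlet character $\chi_{d/2}$ modulo $d/2$ such that, for all integers $n$ with $\gcd(n,d)=1$, $$f(n)=n\,\chi_{d/2}(n)\ \text{ if } f(a)\neq f(a+d),\qquad\text{or}\qquad f(n)=\chi_{d/2}(n)\ \text{ if } f(a)=f(a+d);$$ (2) $d\equiv 2\pmod 4$, and there exists a Dirichlet character $\chi_{d/2}$ modulo $d/2$ such that: if $f(a)\neq f(a+d)$, then $$f(n)=n\,\chi_{d/2}(n)\ \text{ for all } n \text{ with } \gcd(n,d)=1,\quad\text{and}\quad f(2^{\gamma})=2^{\gamma}\chi_{d/2}(2^{\gamma-1})\ \text{ for all integers } \gamma\geq 1;$$ or, if $f(a)=f(a+d)$, then $$f(n)=\chi_{d/2}(n)\ \text{ for all } n \text{ with } \gcd(n,d)=1,\quad\text{and}\quad f(2^{\gamma})=2\,\chi_{d/2}(2^{\gamma-1})\ \text{ for all integers } \gamma\geq 1.$$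
   Context: A function $f:\mathbb{Z}\to\mathbb{C}$ is multiplicative if $f(mn)=f(m)f(n)$ whenever $\gcd(m,n)=1$.
   Formalization: In case (2) with f(a)=f(a+d), the condition f(0)=2 is added when d=2; without it the ''if'' direction fails, e.g. a=3, d=2, f(odd)=1, f(nonzero even)=2, f(0)=5, where f(1+(-1))=5 but f(1)+f(-1)=2. *)

(* Defs.v *)
From HB Require Import structures.
From mathcomp Require Import all_boot all_order all_algebra.
From mathcomp Require Import complex.
From mathcomp Require Import classical_sets reals.
Set Implicit Arguments.
Unset Strict Implicit.
Unset Printing Implicit Defensive.
Import Order.TTheory GRing.Theory Num.Theory.
Local Open Scope classical_set_scope.
Local Open Scope ring_scope.

Definition multiplicative_fun (C : pzRingType) (f : int -> C) : Prop :=
  forall m n : int, coprimez m n -> f (m * n) = f m * f n.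

Definition progression (a d : nat) : set int :=
  [set a%:Z + k * d%:Z | k in [set: int]].

(* The usual extension by 0 to all of Z of a homomorphism (Z/qZ)^* -> C^*.
   For q = 1 it is the constant function 1, also at 0. *)
Definition dirichlet_character (C : pzRingType) (q : nat) (chi : int -> C) : Prop :=
  [/\ forall m n : int, chi (m * n) = chi m * chi n,
      forall n : int, chi (n + q%:Z) = chi n &
      forall n : int, chi n <> 0 <-> coprimez n q%:Z].

(* Main.v *)
Require Import Defs.
From HB Require Import structures.
From mathcomp Require Import all_boot all_order all_algebra.
From mathcomp Require Import complex.
From mathcomp Require Import classical_sets reals.
From mathcomp Require Import ring zify.
Set Implicit Arguments.
Unset Strict Implicit.
Unset Printing Implicit Defensive.
Import Order.TTheory GRing.Theory Num.Theory.
Local Open Scope classical_set_scope.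
Local Open Scope ring_scope.

(** Write q = d/2, so that u + v = 2 k with k = a mod q when u, v = a mod d.

    Additivity on the class of a mod d makes k |-> f (a + k d) affine, with
    slope e = f (a + d) - f a.  If e is nonzero, multiplicativity with the
    factor 1 + d, tested at two members of the class coprime to it, forces
    f (1 + d) = 1 + d, and then that the affine function is linear:
    f n = b n on the class ([linear_on_class]).  If e = 0, f is a constant b
    there.  So in both cases f = b w on the class, where the weight w is the
    identity or the constant 1.  These two functions share all that the rest
    of the proof needs ([mean_weight]): complete multiplicativity, no zero
    outside 0, and the midpoint identity w u + w v = 2 w ((u + v)/2).  The
    last one turns additivity into f (2 k) = 2 b w k for k = a mod q
    ([double_of_additive]).

    That relation already contains the character.  Given m, n odd, coprime to
    q and congruent mod q, choose x coprime to 2 m n with x m = a mod q; then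
    f 2 * f x * f m = 2 b w x w m, and the same with n for m.  Both sides are
    nonzero, so f m / w m = f n / w n ([ratio_congr]).  Hence f / w, defined
    on the units mod d, descends to the units mod q, where it is a
    homomorphism ([exists_character_ratio]).  Applying the relation to
    k = 2^g m with m odd gives the values at powers of 2
    ([two_power_of_double]); when q is even, only f 2 = 2 can be reached.

    Conversely, the values of f at units and at powers of 2 give back
    f (2 k) = 2 chi(a) w k by splitting off the power of 2 in k
    ([double_of_character]), and the midpoint identity gives additivity.
    Only k = 0 escapes; it occurs for d = 2 alone, where f 0 = 2 w 0 is
    needed. *)

(** * Coprime representatives of residue classes *)

Lemma coprimez_congr (q m n : int) :
  (q %| m - n)%Z -> coprimez m q = coprimez n q.
Proof.
suff imp x y : (q %| x - y)%Z -> coprimez x q -> coprimez y q.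
  by move=> mn; apply/idP/idP; apply: imp; rewrite // -opprB rpredN.
move=> /dvdzP[t xy] /coprimezP[[u v] /= uv]; apply/coprimezP.
exists (u, u * t + v) => /=; rewrite -uv.
have -> : x = y + t * q by rewrite -xy; ring.
by ring.
Qed.

(** Only the primes of N outside q constrain m, and the Chinese remainder
    theorem lets m be 1 modulo the part of N that they make up. *)
Lemma exists_coprime_residue (q : nat) (N x : int) :
  (0 < q)%N -> N != 0 -> coprimez x q ->
  exists m : int, (q %| m - x)%Z /\ coprimez m N.
Proof.
move=> q_gt0 N_neq0 xq.
have [q1|q_neq1] := eqVneq q 1%N.
  (* treated apart, since for q = 1 the Chinese remainder could be 0 *)
  by exists 1; rewrite q1 dvd1z coprimezE coprime1n.
have N_gt0 : (0 < `|N|)%N by rewrite absz_gt0.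
pose r : nat := partn `|N|%N \pi(q)^'.
have q_r : coprimez q r.
  by rewrite coprimezE coprime_pi' ?part_pnat ?part_gt0.
pose m := zchinese q r x 1.
have mx : (q %| m - x)%Z by rewrite -eqz_mod_dvd zchinese_modl.
have m1 : (r %| m - 1)%Z by rewrite -eqz_mod_dvd zchinese_modr.
have mq : coprimez m q by rewrite (coprimez_congr mx).
exists m; split=> //.
have m_gt0 : (0 < `|m|)%N.
  rewrite absz_gt0; apply/eqP => m0; move: mq q_neq1.
  by rewrite m0 coprimezE /coprime gcd0n => ->.
rewrite coprimezE -(partnC \pi(q) N_gt0) coprimeMr; apply/andP; split.
  apply: (@p'nat_coprime \pi(q)); last exact: part_pnat.
  by rewrite -coprime_pi' // coprime_sym.
by rewrite -[coprime _ _]/(coprimez m r) (coprimez_congr m1) coprimezE coprime1n.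
Qed.

Lemma exists_coprime_quotient (q : nat) (N a n : int) :
  (0 < q)%N -> N != 0 -> coprimez a q -> coprimez n q ->
  exists m : int, (q %| m * n - a)%Z /\ coprimez m N.
Proof.
move=> q_gt0 N_neq0 aq /coprimezP[[u v] /= uv].
have uq : coprimez u q by apply/coprimezP; exists (n, v); rewrite /= -uv; ring.
have [|m [/dvdzP[t mt] mN]] := exists_coprime_residue (x := u * a) q_gt0 N_neq0.
  by rewrite coprimezMl uq.
exists m; split=> //; apply/dvdzP; exists (t * n - v * a).
transitivity (m * n - a * (u * n + v * q)); first by rewrite uv mulr1.
have -> : m = t * q + u * a by rewrite -mt; ring.
by ring.
Qed.

(** * From additivity to a weight *)

Lemma affine_of_additive_sums (V : zmodType) (F : int -> V) :
    (forall k l, F (k + l) + F 0 = F k + F l) ->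
  forall k, F k = F 0 + (F 1 - F 0) *~ k.
Proof.
move=> addF; elim/int_rect => [|n IH|n IH]; first by rewrite mulr0z addr0.
- apply: (addIr (F 0)); rewrite -addn1 PoszD addF IH mulrzDr mulr1z.
  by rewrite !addrA subrK.
- apply: (addIr (F 1)); rewrite -addF.
  have -> : - n.+1%:Z = - n%:Z - 1 by lia.
  by rewrite subrK IH mulrzBr mulr1z opprB !addrA subrK.
Qed.

Definition additive_on_class (C : pzRingType) (f : int -> C) (a d : int) : Prop :=
  forall u v, (d %| u - a)%Z -> (d %| v - a)%Z -> f (u + v) = f u + f v.

Lemma affine_on_class (C : pzRingType) (f : int -> C) (a d k : int) :
  additive_on_class f a d -> f (a + k * d) = f a + (f (a + d) - f a) * k%:~R.
Proof.
move=> f_add; pose F k := f (a + k * d).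
have modP l : (d %| a + l * d - a)%Z by rewrite addrC addKr dvdz_mull.
have := @affine_of_additive_sums _ F _ k; rewrite /F mul0r mul1r addr0 mulrzr.
by apply=> l m; rewrite -[in LHS]f_add ?subrr ?dvdz0 // -f_add //; congr f; ring.
Qed.

(** Multiplying a + k d by 1 + d moves k to a + k (1 + d) in the class, which
    gives f a + e (a + k (1 + d)) = f (1 + d) (f a + e k) whenever 1 + d and
    a + k d are coprime.  The two instances k = a - 1 and k = a + 1 determine
    f (1 + d) and the ratio of f a to e. *)
Lemma linear_on_class (C : numFieldType) (f : int -> C) (a d : int) :
    d != 0 -> multiplicative_fun f -> additive_on_class f a d ->
    f (a + d) != f a ->
  exists2 b, b != 0 & forall n, (d %| n - a)%Z -> f n = b * n%:~R.
Proof.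
move=> d_neq0 f_mul f_add fa_neq; set e := f (a + d) - f a.
have f_aff k : f (a + k * d) = f a + e * k%:~R by exact: affine_on_class.
have e_neq0 : e != 0 by rewrite subr_eq0.
have dC_neq0 : d%:~R != 0 :> C by rewrite intr_eq0.
have f_mul1d k : coprimez (1 + d) (a + k * d) ->
    f a + e * (a + k * (1 + d))%:~R = f (1 + d) * (f a + e * k%:~R).
  by move=> /f_mul; rewrite -!f_aff => <-; congr f; ring.
have f_pred : f a + e * (a + (a - 1) * (1 + d))%:~R =
    f (1 + d) * (f a + e * (a - 1)%:~R).
  (* a + (a - 1) d = (a - 1) (1 + d) + 1 *)
  by apply: f_mul1d; apply/coprimezP; exists (1 - a, 1) => /=; ring.
have f_succ : f a + e * (a + (a + 1) * (1 + d))%:~R =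
    f (1 + d) * (f a + e * (a + 1)%:~R).
  (* a + (a + 1) d = (a + 1) (1 + d) - 1 *)
  by apply: f_mul1d; apply/coprimezP; exists (a + 1, -1) => /=; ring.
have f_1d : f (1 + d) = 1 + d%:~R.
  apply: (mulIf e_neq0); apply: (mulIf (_ : 2 != 0)); first by rewrite pnatr_eq0.
  have -> : f (1 + d) * e * 2 =
     f (1 + d) * (f a + e * (a + 1)%:~R) - f (1 + d) * (f a + e * (a - 1)%:~R).
    by rewrite !rmorphE /=; ring.
  by rewrite -f_pred -f_succ !rmorphE /=; ring.
have fa_d : f a * d%:~R = e * a%:~R.
  have := f_succ; rewrite f_1d !rmorphE /= => /eqP; rewrite -subr_eq0 => /eqP E.
  by apply: subr0_eq; rewrite -[RHS]oppr0 -E; ring.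
exists (e / d%:~R); first by rewrite mulf_neq0 ?invr_eq0.
move=> n /dvdzP[k nk]; have -> : n = a + k * d by rewrite -nk; ring.
rewrite f_aff; apply: (mulIf dC_neq0).
by rewrite mulrDl fa_d !rmorphE /=; field.
Qed.

(** What the functions 1 and n |-> n have in common.  Working with an arbitrary
    w of this kind treats f a = f (a + d) and f a <> f (a + d) at once. *)
Definition mean_weight (C : pzRingType) (w : int -> C) : Prop :=
  [/\ forall m n, w (m * n) = w m * w n,
      forall n, n != 0 -> w n != 0 &
      forall u v k, u + v = 2 * k -> w u + w v = 2 * w k].

Lemma mean_weight_1 (C : numDomainType) : mean_weight (fun=> 1 : C).
Proof. by split=> [*|*|*]; rewrite ?mulr1 ?oner_eq0. Qed.

Lemma mean_weight_id (C : numDomainType) : mean_weight (intr : int -> C).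
Proof.
split=> [m n|n|u v k uv]; rewrite ?intrM ?intr_eq0 //.
by rewrite -intrD uv intrM.
Qed.

Lemma weight_of_additive (C : numFieldType) (f : int -> C) (a d : int) :
    d != 0 -> f a != 0 -> multiplicative_fun f -> additive_on_class f a d ->
  exists w b, [/\ mean_weight w, b != 0,
    forall n, (d %| n - a)%Z -> f n = b * w n &
    f a <> f (a + d) /\ w = intr \/ f a = f (a + d) /\ w = fun=> 1].
Proof.
move=> d_neq0 fa_neq0 f_mul f_add.
have [fa_eq|fa_neq] := eqVneq (f (a + d)) (f a).
  exists (fun=> 1), (f a); split=> //; [exact: mean_weight_1| |by right].
  move=> n /dvdzP[k nk]; have -> : n = a + k * d by rewrite -nk; ring.
  by rewrite (affine_on_class _ f_add) fa_eq subrr mul0r addr0 mulr1.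
have [b b_neq0 f_lin] := linear_on_class d_neq0 f_mul f_add fa_neq.
exists intr, b; split=> //; first exact: mean_weight_id.
by left; split=> // /esym/eqP; apply/negP.
Qed.

Lemma double_of_additive (C : comPzRingType) (f w : int -> C) (a : int) (q : nat) b :
    mean_weight w -> additive_on_class f a (2 * q%:Z) ->
    (forall n, (2 * q%:Z %| n - a)%Z -> f n = b * w n) ->
  forall k, (q %| k - a)%Z -> f (2 * k) = 2 * b * w k.
Proof.
move=> [_ _ w_mean] f_add fP k /dvdzP[t kt].
have aP : (2 * q%:Z %| a - a)%Z by rewrite subrr dvdz0.
have vP : (2 * q%:Z %| 2 * k - a - a)%Z.
  apply/dvdzP; exists t.
  have -> : k = t * q + a by rewrite -kt; ring.
  by ring.
have -> : 2 * k = a + (2 * k - a) by ring.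
rewrite f_add // !fP // -mulrDr (w_mean _ _ k); first by ring.
by ring.
Qed.

(** * The character *)

Lemma coprimez2 (n : int) : coprimez n 2 = ~~ (2 %| n)%Z.
Proof. by rewrite coprimezE coprimen2 dvdzE dvdn2 negbK. Qed.

Lemma coprimez_double (n : int) (q : nat) :
  coprimez n (2 * q%:Z) = ~~ (2 %| n)%Z && coprimez n q.
Proof. by rewrite coprimezMr coprimez2. Qed.

(** For x coprime to 2 m n and with x m = x n = a mod q, the value of f at
    2 x m and at 2 x n splits into three factors, of which f 2 and f x are
    common.  The nonvanishing of f m comes out of the same equation. *)
Lemma ratio_congr (C : fieldType) (f w : int -> C) (a : int) (q : nat) b :
    (2 : C) != 0 -> (0 < q)%N -> coprimez a q -> b != 0 ->
    multiplicative_fun f -> mean_weight w ->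
    (forall k, (q %| k - a)%Z -> f (2 * k) = 2 * b * w k) ->
  forall m n, m != 0 -> n != 0 ->
    coprimez m (2 * q%:Z) -> coprimez n (2 * q%:Z) ->
    (q %| m - n)%Z -> f m / w m = f n / w n /\ f m != 0.
Proof.
move=> nz2 q_gt0 aq b_neq0 f_mul [wM w_neq0 _] f_dbl m n m_neq0 n_neq0.
rewrite !coprimez_double => /andP[m_odd mq] /andP[n_odd nq] mn.
have N_neq0 : 2 * m * n != 0 by rewrite !mulf_neq0.
have [x [xm]] := exists_coprime_quotient q_gt0 N_neq0 aq mq.
rewrite !coprimezMr -andbA => /and3P[x2 x_m x_n].
have x_neq0 : x != 0 by apply: contraTneq x2 => ->.
have xn : (q %| x * n - a)%Z.
  have -> : x * n - a = x * m - a - x * (m - n) by ring.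
  by rewrite rpredB // dvdz_mull.
have key y : coprimez x y -> ~~ (2 %| y)%Z -> (q %| x * y - a)%Z ->
    f 2 * f x * f y = 2 * b * w x * w y.
  move=> x_y y_odd /f_dbl; rewrite wM [in RHS]mulrA => <-.
  rewrite f_mul; first by rewrite (f_mul x y) ?mulrA.
  by rewrite coprimez_sym coprimezMl x2 coprimez2.
have km := key m x_m m_odd xm; have kn := key n x_n n_odd xn.
have rhs_neq0 y : y != 0 -> 2 * b * w x * w y != 0.
  by move=> y_neq0; rewrite !mulf_neq0 ?w_neq0.
have := rhs_neq0 m m_neq0; rewrite -km !mulf_eq0 !negb_or.
case/andP=> /andP[f2 fx] fm.
split=> //; apply: (mulfI (mulf_neq0 f2 fx)).
by rewrite !mulrA km kn !mulfK ?w_neq0.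
Qed.

(** Multiplicativity of f gives f / w only on coprime arguments; to multiply
    the classes of m and n mod q, m is first moved inside its class to become
    coprime to n. *)
Lemma exists_character_ratio (C : fieldType) (f w : int -> C) (a : int) (q : nat) b :
    (2 : C) != 0 -> (0 < q)%N -> coprimez a q -> b != 0 ->
    multiplicative_fun f -> mean_weight w ->
    (forall k, (q %| k - a)%Z -> f (2 * k) = 2 * b * w k) ->
  exists chi, dirichlet_character q chi /\
    forall n, coprimez n (2 * q%:Z) -> f n = w n * chi n.
Proof.
move=> nz2 q_gt0 aq b_neq0 f_mul w_wt f_dbl; have [wM w_neq0 _] := w_wt.
pose h n := f n / w n.
have unit_neq0 n : coprimez n (2 * q%:Z) -> n != 0.
  by rewrite coprimez_double => /andP[n_odd _]; apply: contraNneq n_odd => ->.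
have h_congr m n : coprimez m (2 * q%:Z) -> coprimez n (2 * q%:Z) ->
    (q %| m - n)%Z -> h m = h n /\ f m != 0.
  move=> m_u n_u; apply: (ratio_congr nz2 q_gt0 aq b_neq0 f_mul w_wt f_dbl);
    by [|exact: unit_neq0].
have hM m n : coprimez m (2 * q%:Z) -> coprimez n (2 * q%:Z) ->
    h (m * n) = h m * h n.
  move=> m_u n_u.
  have N_neq0 : 2 * q%:Z * n != 0.
    by rewrite mulf_neq0 ?(unit_neq0 n) // mulf_neq0 // eqz_nat -lt0n.
  have [|x [xm]] := exists_coprime_residue (x := m) q_gt0 N_neq0.
    by move: m_u; rewrite coprimez_double => /andP[].
  rewrite coprimezMr => /andP[x_u xn].
  have [<- _] := h_congr x m x_u m_u xm.
  have [<- _] : h (x * n) = h (m * n) /\ f (x * n) != 0.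
    apply: h_congr; rewrite ?coprimezMl ?x_u ?m_u //.
    by rewrite -mulrBl dvdz_mulr.
  by rewrite /h f_mul // wM invfM mulrACA.
(* every unit modulo q has an odd representative, among n and n + q *)
pose odd_rep n : int := if (2 %| n)%Z then n + q%:Z else n.
have rep_congr n : (q %| odd_rep n - n)%Z.
  by rewrite /odd_rep; case: ifP => _; rewrite ?subrr ?dvdz0 // addrC addKr.
have rep_unit n : coprimez n q -> coprimez (odd_rep n) (2 * q%:Z).
  move=> nq; rewrite coprimez_double (coprimez_congr (rep_congr n)) nq andbT.
  rewrite /odd_rep; case: ifP => [n_even|->] //; rewrite rpredDl //.
  apply: contraTN nq => q_even; apply/negP => /coprimezP[[u v] /= uv].
  have : (2 %| u * n + v * q%:Z)%Z by rewrite rpredD // dvdz_mull.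
  by rewrite uv.
exists (fun n => if coprimez n q then h (odd_rep n) else 0); split; last first.
  move=> n n_u; have := n_u; rewrite coprimez_double => /andP[n_odd nq].
  by rewrite nq /odd_rep (negbTE n_odd) mulrC divfK ?w_neq0 ?unit_neq0.
split=> [m n|n|n].
- rewrite coprimezMl; case: (boolP (coprimez m q)) => /= mq; last by rewrite mul0r.
  case: (boolP (coprimez n q)) => /= nq; last by rewrite mulr0.
  rewrite -hM ?rep_unit //; apply: (proj1 (h_congr _ _ _ _ _)).
  + by rewrite rep_unit // coprimezMl mq.
  + by rewrite coprimezMl !rep_unit.
  have -> : odd_rep (m * n) - odd_rep m * odd_rep n =
     (odd_rep (m * n) - m * n)
     - ((odd_rep m - m) * odd_rep n + m * (odd_rep n - n)).
    by ring.
  by apply: rpredB => //; apply: rpredD; [exact: dvdz_mulr|exact: dvdz_mull].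
- have nq_n : (q %| n + q%:Z - n)%Z by rewrite addrC addKr.
  rewrite (coprimez_congr nq_n); case: ifP => // nq.
  apply: (proj1 (h_congr _ _ _ _ _)); rewrite ?rep_unit ?(coprimez_congr nq_n) //.
  have -> : odd_rep (n + q%:Z) - odd_rep n =
    (odd_rep (n + q%:Z) - (n + q%:Z)) + (n + q%:Z - n) - (odd_rep n - n) by ring.
  by rewrite rpredB // rpredD.
- case: ifP => nq; split=> //.
  move=> _; apply/eqP; have n_u := rep_unit n nq.
  rewrite mulf_neq0 ?invr_eq0 ?w_neq0 ?unit_neq0 //.
  by apply: (proj2 (h_congr _ _ n_u n_u _)); rewrite subrr dvdz0.
Qed.

Lemma character_congr (C : pzRingType) (q : nat) (chi : int -> C) (m n : int) :
  dirichlet_character q chi -> (q %| m - n)%Z -> chi m = chi n.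
Proof.
case=> _ chiD _ /dvdzP[k mn].
have -> : m = n + k * q%:Z by rewrite -mn; ring.
elim/int_rect: k {mn} => [|k IH|k IH]; first by rewrite mul0r addr0.
- by rewrite -IH -[RHS]chiD; congr chi; rewrite -addn1 PoszD; ring.
- by rewrite -IH -[LHS]chiD; congr chi; rewrite -addn1 PoszD; ring.
Qed.

Lemma character_neq0 (C : pzRingType) (q : nat) (chi : int -> C) (n : int) :
  dirichlet_character q chi -> coprimez n q -> chi n != 0.
Proof. by case=> _ _ chi0 /chi0/eqP. Qed.

(** Evaluate f at 2^(g+1) m, with m odd and 2^g m = a mod q, in two ways. *)
Lemma two_power_of_double (C : fieldType) (f w chi : int -> C) (a : int) (q : nat) g :
    (0 < q)%N -> coprimez a q ->
    multiplicative_fun f -> mean_weight w -> dirichlet_character q chi ->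
    (forall n, coprimez n (2 * q%:Z) -> f n = w n * chi n) ->
    (forall k, (q %| k - a)%Z -> f (2 * k) = 2 * chi a * w k) ->
    coprimez (2 ^+ g) q ->
  f (2 ^+ g.+1) = 2 * w (2 ^+ g) * chi (2 ^+ g).
Proof.
move=> q_gt0 aq f_mul [wM w_neq0 _] chiP f_chi f_dbl gq.
have [|m [ma m_u]] := exists_coprime_quotient (N := 2 * q%:Z) q_gt0 _ aq gq.
  by rewrite mulf_neq0 // eqz_nat -lt0n.
have := m_u; rewrite coprimez_double => /andP[m_odd mq].
have m_neq0 : m != 0 by apply: contraNneq m_odd => ->.
have wchi_neq0 : w m * chi m != 0.
  by rewrite mulf_neq0 ?w_neq0 // (character_neq0 chiP).
apply: (mulIf wchi_neq0); rewrite -f_chi // -f_mul; last first.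
  by rewrite coprimezXl // coprimez_sym coprimez2.
have -> : 2 ^+ g.+1 * m = 2 * (m * 2 ^+ g) :> int by rewrite exprS; ring.
have [chiM _ _] := chiP.
by rewrite f_dbl // wM -(character_congr chiP ma) chiM f_chi //; ring.
Qed.

(** Write k = 2^g m with m odd; f is known at 2^(g+1) and at m, and
    chi k = chi a because k = a mod q. *)
Lemma double_of_character (C : comPzRingType) (f w chi : int -> C) (a k : int) (q : nat) :
    coprimez a q -> multiplicative_fun f -> mean_weight w ->
    dirichlet_character q chi ->
    (forall n, coprimez n (2 * q%:Z) -> f n = w n * chi n) ->
    (forall g, coprimez (2 ^+ g) q ->
      f (2 ^+ g.+1) = 2 * w (2 ^+ g) * chi (2 ^+ g)) ->
    k != 0 -> (q %| k - a)%Z ->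
  f (2 * k) = 2 * chi a * w k.
Proof.
move=> aq f_mul [wM _ _] chiP f_chi f_two k_neq0 ka.
have [chiM _ _] := chiP.
have [g [m [k_eq m_odd]]] : exists g m, k = 2 ^+ g * m /\ ~~ (2 %| m)%Z.
  exists (logn 2 `|k|), (k %/ 2 ^+ logn 2 `|k|)%Z.
  have k_gt0 : (0 < `|k|)%N by rewrite absz_gt0.
  have dvd_k : (2 ^+ logn 2 `|k| %| k)%Z by rewrite dvdzE abszX pfactor_dvdnn.
  split; first by rewrite mulrC divzK.
  have : ~~ (2 ^+ (logn 2 `|k|).+1 %| k)%Z.
    by rewrite dvdzE abszX pfactor_dvdn // ltnn.
  apply: contra => /dvdzP[t kt]; apply/dvdzP; exists t.
  by rewrite -[LHS](divzK dvd_k) kt exprS mulrA.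
rewrite -(character_congr chiP ka).
have := aq; rewrite -(coprimez_congr ka) k_eq coprimezMl => /andP[gq mq].
have m_u : coprimez m (2 * q%:Z) by rewrite coprimez_double m_odd.
rewrite mulrA -exprS f_mul ?f_two ?f_chi ?wM ?chiM //; first by ring.
by rewrite coprimezXl // coprimez_sym coprimez2.
Qed.

(** * The two directions *)

Lemma character_of_additive (C : numFieldType) (f w : int -> C) (a : int) (q : nat) b :
    (0 < q)%N -> coprimez a (2 * q%:Z) -> b != 0 ->
    multiplicative_fun f -> mean_weight w -> additive_on_class f a (2 * q%:Z) ->
    (forall n, (2 * q%:Z %| n - a)%Z -> f n = b * w n) ->
  exists chi, [/\ dirichlet_character q chi,
    forall n, coprimez n (2 * q%:Z) -> f n = w n * chi n &
    forall g, coprimez (2 ^+ g) q ->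
      f (2 ^+ g.+1) = 2 * w (2 ^+ g) * chi (2 ^+ g)].
Proof.
move=> q_gt0 a_unit b_neq0 f_mul w_wt f_add fP.
have f_dbl := double_of_additive w_wt f_add fP.
have := a_unit; rewrite coprimez_double => /andP[a_odd aq].
have nz2 : (2 : C) != 0 by rewrite pnatr_eq0.
have [chi [chiP f_chi]] :=
  exists_character_ratio nz2 q_gt0 aq b_neq0 f_mul w_wt f_dbl.
have a_neq0 : a != 0 by apply: contraNneq a_odd => ->.
have b_chi : b = chi a.
  have [_ w_neq0 _] := w_wt; apply: (mulIf (w_neq0 a a_neq0)).
  by rewrite -fP ?subrr ?dvdz0 // f_chi // mulrC.
rewrite {}b_chi in f_dbl; exists chi; split=> // g gq.
exact: (two_power_of_double q_gt0 aq f_mul w_wt chiP f_chi f_dbl gq).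
Qed.

Lemma weight_one (C : fieldType) (w : int -> C) : mean_weight w -> w 1 = 1.
Proof.
case=> wM w_neq0 _; apply: (mulfI (w_neq0 1 isT)).
by rewrite -wM !mulr1.
Qed.

Lemma character_one (C : fieldType) (q : nat) (chi : int -> C) :
  dirichlet_character q chi -> chi 1 = 1.
Proof.
move=> chiP; have chi1 := character_neq0 chiP (coprime1n q : coprimez 1 q).
by apply: (mulfI chi1); have [chiM _ _] := chiP; rewrite -chiM !mulr1.
Qed.

Lemma character_modulus1 (C : fieldType) (chi : int -> C) (n : int) :
  dirichlet_character 1 chi -> chi n = 1.
Proof.
move=> chiP; rewrite -(character_one chiP).
by apply: (character_congr chiP); rewrite dvd1z.
Qed.

Lemma additive_of_character (C : fieldType) (f w chi : int -> C) (a : int) (q : nat) :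
    coprimez a (2 * q%:Z) ->
    multiplicative_fun f -> mean_weight w -> dirichlet_character q chi ->
    (forall n, coprimez n (2 * q%:Z) -> f n = w n * chi n) ->
    (forall g, coprimez (2 ^+ g) q ->
      f (2 ^+ g.+1) = 2 * w (2 ^+ g) * chi (2 ^+ g)) ->
    (q = 1%N -> f 0 = 2 * w 0) ->
  additive_on_class f a (2 * q%:Z).
Proof.
move=> a_unit f_mul w_wt chiP f_chi f_two f_0 u v ua va.
have := a_unit; rewrite coprimez_double => /andP[a_odd aq].
have fP x : (2 * q%:Z %| x - a)%Z -> f x = w x * chi a.
  move=> xa; rewrite f_chi ?(coprimez_congr xa) //; congr (_ * _).
  by apply: (character_congr chiP); apply: dvdz_trans xa; exact: dvdz_mull.
have [k [uvk ka]] : exists k, u + v = 2 * k /\ (q %| k - a)%Z.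
  have /dvdzP[i ui] := ua; have /dvdzP[j vj] := va.
  have u_eq : u = a + i * (2 * q%:Z) by rewrite -ui; ring.
  have v_eq : v = a + j * (2 * q%:Z) by rewrite -vj; ring.
  exists (a + (i + j) * q%:Z); split; first by rewrite u_eq v_eq; ring.
  by rewrite addrC addKr dvdz_mull.
have [_ _ w_mean] := w_wt.
rewrite (fP u ua) (fP v va) -mulrDl (w_mean _ _ _ uvk) uvk.
have [k0|k_neq0] := eqVneq k 0; last first.
  by rewrite (double_of_character aq f_mul w_wt chiP f_chi f_two) //; ring.
have q1 : q = 1%N.
  move: aq; rewrite -(coprimez_congr ka) k0 coprimezE /coprime gcd0n.
  by move/eqP.
have chi_a : chi a = 1 by apply: character_modulus1; rewrite -q1.
by rewrite k0 mulr0 f_0 // chi_a mulr1.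
Qed.

(* For d = 2 the sums u + v include 0, and multiplicativity leaves f 0 free when
   f (-1) = 1; the last conjunct pins it down. See NOTES.md, FIDELITY. *)
Theorem theorem2 (R : realType) (a d : nat) (f : int -> R[i])
    (a_gt1 : (1 < a)%N) (d_gt1 : (1 < d)%N) (d_even : ~~ odd d)
    (co_ad : coprime a d) (f_mul : multiplicative_fun f)
    (fa_neq0 : f a%:Z <> 0) :
  (forall u v : int, progression a d u -> progression a d v ->
     f (u + v) = f u + f v)
  <->
  ([/\ d = 0 %[mod 4], f 2 = 2 &
       exists chi : int -> R[i], dirichlet_character (d %/ 2) chi /\
         forall n : int, coprimez n d%:Z ->
           (f a%:Z <> f (a%:Z + d%:Z) -> f n = n%:~R * chi n) /\
           (f a%:Z = f (a%:Z + d%:Z) -> f n = chi n)]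
   \/
   (d = 2 %[mod 4] /\
    exists chi : int -> R[i], dirichlet_character (d %/ 2) chi /\
      (f a%:Z <> f (a%:Z + d%:Z) ->
         (forall n : int, coprimez n d%:Z -> f n = n%:~R * chi n) /\
         (forall g : nat, (1 <= g)%N -> f (2 ^+ g) = 2 ^+ g * chi (2 ^+ g.-1))) /\
      (f a%:Z = f (a%:Z + d%:Z) ->
         [/\ forall n : int, coprimez n d%:Z -> f n = chi n,
             forall g : nat, (1 <= g)%N -> f (2 ^+ g) = 2 * chi (2 ^+ g.-1) &
             d = 2%N -> f 0 = 2]))).
Proof.
set q := (d %/ 2)%N.
have d_eq : d%:Z = 2 * q%:Z by rewrite /q; lia.
have q_gt0 : (0 < q)%N by rewrite /q; lia.
have a_unit : coprimez a (2 * q%:Z) by rewrite -d_eq.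
have progP u : progression a d u <-> (2 * q%:Z %| u - a%:Z)%Z.
  rewrite -d_eq; split=> [[k _ <-]|/dvdzP[k uk]].
    by rewrite addrC addKr dvdz_mull.
  by exists k => //; rewrite -uk; ring.
have two_unit : odd q -> forall g, coprimez (2 ^+ g) q.
  by move=> q_odd g; rewrite coprimezXl // coprimezE coprime2n.
have two_not_unit g : ~~ odd q -> coprimez (2 ^+ g.+1) q = false.
  by move=> q_even; rewrite coprimez_pexpl // coprimezE coprime2n (negbTE q_even).
split=> [f_add|].
  have {}f_add : additive_on_class f a (2 * q%:Z).
    by move=> u v /progP ua /progP va; apply: f_add.
  have m_neq0 : 2 * q%:Z != 0 by rewrite -d_eq; lia.
  have fa : f a != 0 by apply/eqP.
  have [w [b [w_wt b_neq0 fP w_eq]]] :=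
    weight_of_additive m_neq0 fa f_mul f_add.
  rewrite -d_eq in w_eq.
  have [chi [chiP f_chi f_two]] :=
    character_of_additive q_gt0 a_unit b_neq0 f_mul w_wt f_add fP.
  have [d0|d2] : d = 0 %[mod 4] \/ d = 2 %[mod 4] by lia.
    left; split=> //.
      have := f_two 0.
      rewrite expr1 expr0 (weight_one w_wt) (character_one chiP) => ->.
        by rewrite !mulr1.
      by rewrite coprimezE coprime1n.
    exists chi; split=> // n n_unit.
    have : f n = w n * chi n by rewrite f_chi -?d_eq.
    by case: w_eq => -[fa_eq ->] ->; split=> //; rewrite mul1r.
  right; split=> //; exists chi; split=> //.
  have q_odd : odd q by rewrite /q; lia.
  have f2 g : (1 <= g)%N -> f (2 ^+ g) = 2 * w (2 ^+ g.-1) * chi (2 ^+ g.-1).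
    by case: g => // g _; apply/f_two/two_unit.
  case: w_eq f_chi f2 => -[fa_eq ->] f_chi f2; split=> // _.
    split=> [n n_unit|g g_gt0]; first by rewrite f_chi -?d_eq.
    rewrite f2 //; case: g g_gt0 => // g _.
    by rewrite exprS rmorphXn.
  split=> [n n_unit|g g_gt0|d_2].
  - by rewrite f_chi -?d_eq // mul1r.
  - by rewrite f2 // mulr1.
  - have a_odd : odd a by move: co_ad; rewrite d_2 coprimen2.
    have one_unit : coprimez 1 d by rewrite coprimezE coprime1n.
    have mone_unit : coprimez (-1) d by rewrite coprimezE coprime1n.
    have chi1 n : chi n = 1.
      by apply: character_modulus1; move: chiP; rewrite /q d_2.
    have -> : f 0 = f 1 + f (-1).
      by rewrite -f_add ?subrr // -d_eq d_2; lia.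
    by rewrite !f_chi -?d_eq // !chi1 mulr1.
have w_fits (w : int -> R[i]) (chi : int -> R[i]) :
    mean_weight w -> dirichlet_character q chi ->
    (forall n, coprimez n d -> f n = w n * chi n) ->
    (forall g, coprimez (2 ^+ g) q ->
      f (2 ^+ g.+1) = 2 * w (2 ^+ g) * chi (2 ^+ g)) ->
    (d = 2%N -> f 0 = 2 * w 0) ->
    forall u v, progression a d u -> progression a d v -> f (u + v) = f u + f v.
  move=> w_wt chiP f_chi f_two f_0 u v /progP ua /progP va.
  apply: (additive_of_character a_unit f_mul w_wt chiP _ f_two) ua va.
    by move=> n; rewrite -d_eq; apply: f_chi.
  by move=> q1; apply: f_0; move: q1 d_even; rewrite /q; lia.
case=> [[d0 f2 [chi [chiP f_chi]]]|[d2 [chi [chiP [f_lin f_const]]]]].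
  have q_even : ~~ odd q by rewrite /q; lia.
  (* q is even, so that g = 0 is the only exponent to check *)
  have f_two w : mean_weight w -> forall g, coprimez (2 ^+ g) q ->
      f (2 ^+ g.+1) = 2 * w (2 ^+ g) * chi (2 ^+ g).
    move=> w_wt [_|g]; last by rewrite two_not_unit.
    by rewrite expr1 expr0 (weight_one w_wt) (character_one chiP) !mulr1.
  have d_neq2 : d <> 2%N by move=> d2; rewrite d2 in d0.
  have [fa_eq|/eqP fa_neq] := eqVneq (f a%:Z) (f (a%:Z + d%:Z)).
    have w_wt := mean_weight_1 R[i].
    apply: (w_fits _ _ w_wt chiP _ (f_two _ w_wt)) => // n n_unit.
    by rewrite mul1r; apply: (proj2 (f_chi n n_unit)).
  have w_wt := mean_weight_id R[i].
  apply: (w_fits _ _ w_wt chiP _ (f_two _ w_wt)) => // n n_unit.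
  exact: (proj1 (f_chi n n_unit)).
have [fa_eq|/eqP fa_neq] := eqVneq (f a%:Z) (f (a%:Z + d%:Z)).
  have [f_chi f_two f_0] := f_const fa_eq.
  apply: (w_fits _ _ (mean_weight_1 R[i]) chiP) => [n n_unit|g _|d_2].
  - by rewrite mul1r f_chi.
  - by rewrite f_two // mulr1.
  - by rewrite f_0 // mulr1.
have [f_chi f_two] := f_lin fa_neq.
apply: (w_fits _ _ (mean_weight_id R[i]) chiP) => [//|g _|d_2].
  by rewrite f_two // exprS rmorphXn.
(* for d = 2 multiplicativity at the coprime pair -1, 0 gives f 0 = - f 0 *)
have f_m1 : f (-1) = -1.
  rewrite f_chi ?coprimezE ?coprime1n // character_modulus1 ?mulr1 //.
  by move: chiP; rewrite /q d_2.
have /eqP : f 0 = - f 0.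
  by rewrite -mulN1r -f_m1 -f_mul ?mulr0 // coprimezE coprime1n.
rewrite -subr_eq0 opprK -mulr2n mulrn_eq0 /= => /eqP ->.
by rewrite mulr0z mulr0.
Qed.
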